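(* Let $1\le k\le n$ be integers. Then all eigenvalues of the arrangement graph $A(n,k,1)$ are integers.
   Context: Write $[n]=\{1,\dots,n\}$. For $1\le r\le k\le n$, the $(n,k,r)$-arrangement graph $A(n,k,r)$ has as vertices all $k$-permutations of $[n]$, i.e. all vectors $(p_1,\dots,p_k)$ with $p_i\in[n]$ and $p_i\ne p_j$ for $i\neq j$; two vertices $(p_1,\dots,p_k)$ and $(q_1,\dots,q_k)$ are adjacent if and only if they differ in exactly $r$ positions. Thus in $A(n,k,1)$ two $k$-permutations are adjacent if and only if they differ in exactly one position. The eigenvalues of a graph are the eigenvalues of its adjacency matrix. *)

(* Defs.v *)
From mathcomp Require Import all_boot all_order all_algebra.

Set Implicit Arguments.
Unset Strict Implicit.
Unset Printing Implicit Defensive.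

Import GRing.Theory.

Local Open Scope ring_scope.

(* The k-permutations of [n]: vectors (p_1, ..., p_k) with pairwise distinct  *)
(* entries; [n] is represented by 'I_n = {0, ..., n-1}.                       *)
Definition kperm (n k : nat) : finType :=
  {p : {ffun 'I_k -> 'I_n} | injectiveb p}.

Definition arrangement (n k r : nat) : rel (kperm n k) :=
  fun p q => #|[set i : 'I_k | val p i != val q i]| == r.

Lemma arrangement_sym (n k r : nat) : symmetric (@arrangement n k r).
Proof.
by move=> p q; rewrite /arrangement; congr (#|pred_of_set _| == r);
  apply/setP=> i; rewrite !inE eq_sym.
Qed.

Lemma arrangement_irrefl (n k r : nat) :
  (0 < r)%N -> irreflexive (@arrangement n k r).
Proof.
move=> r_gt0 p; rewrite /arrangement (_ : [set i | _] = set0).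
  by rewrite cards0 eq_sym; case: r r_gt0.
by apply/setP=> i; rewrite !inE eqxx.
Qed.

(* Matrices are indexed by ordinals: the vertices are numbered by enum_val.   *)
Definition adjmx (F : fieldType) (V : finType) (e : rel V) : 'M[F]_#|V| :=
  \matrix_(i, j) (e (enum_val i) (enum_val j))%:R.

(* Main.v *)
Require Import Defs.
From mathcomp Require Import all_boot all_order all_algebra.
From mathcomp Require Import all_fingroup spectral mxrepresentation.
From mathcomp Require Import ring.

Set Implicit Arguments.
Unset Strict Implicit.
Unset Printing Implicit Defensive.

Local Open Scope ring_scope.

Import GRing.Theory.

(** A k-permutation of [n] is the restriction of a permutation s of [n] to the
    first k positions, and its neighbours in A(n,k,1) are the restrictions of
    s precomposed with a transposition (i j), where i is one of the first k
    positions and j one of the n - k others ([arrangement_swapP]).  Hence an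
    eigenfunction of A(n,k,1) for a, read as a function on S_n, is an
    eigenvector of the sum of all (i j) with i < k <= j in the regular
    representation.  Precomposing with a transposition of two of the last
    n - k positions does not change the restriction, so adding all of those
    only shifts the eigenvalue by a natural number c
    ([sum_jucys_murphy_restrict]).  What has been obtained is
    X_k + ... + X_(n-1), where X_m is the Jucys-Murphy element, the sum of the
    transpositions (i m) with i < m.

    The X_m commute ([jucys_murphy_comm]), so a + c is a sum of eigenvalues of
    individual X_m, and it remains to see that these are integers
    ([jucys_murphy_integral]).  This goes by induction on m: with s = (m m+1),
    the relation X_(m+1) s = s X_m + 1 forces every eigenvalue of X_(m+1)
    to be an eigenvalue of X_m, or to differ by 1 from one
    ([integral_spectrum_hecke]). *)

(** * Matrices with integer eigenvalues *)

Section IntegralSpectrum.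

Variable C : numClosedFieldType.

Definition integral_spectrum d (A : 'M[C]_d) :=
  forall a, eigenvalue A a -> exists z : int, a = z%:~R.

(** The matrix B preserves the eigenspace of A for a, and over an algebraically
    closed field its restriction there has an eigenvector. *)
Lemma comm_mx_common_eigenvector d (A B : 'M[C]_d) a :
    comm_mx A B -> eigenvalue A a ->
  exists b, exists2 v : 'rV_d, v != 0 & v *m A = a *: v /\ v *m B = b *: v.
Proof.
move=> cAB aA.
have stB : stablemx (row_base (eigenspace A a)) B.
  by rewrite stablemx_row_base; apply: comm_mx_stable_eigenspace.
have [|b /eigenvalueP[w wB w_neq0]] :=
  eigenvalue_closed (restrictmx (eigenspace A a) B).
  by rewrite lt0n mxrank_eq0.
exists b, (w *m row_base (eigenspace A a)).
  by rewrite mulmx_free_eq0 ?row_base_free.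
split; apply/eigenspaceP; first by rewrite mulmx_sub // eq_row_base.
rewrite -sub_eigenspace_conjmx ?row_base_free //; exact/eigenspaceP.
Qed.

Lemma integral_spectrum0 d : integral_spectrum (0 : 'M[C]_d).
Proof.
move=> a /eigenvalueP[v /esym/eqP]; rewrite mulmx0 scaler_eq0.
by case/orP=> [/eqP-> _|/eqP->]; [exists 0 | rewrite eqxx].
Qed.

(** On a common eigenvector of A + B and B, the matrix A acts as a scalar too,
    so an eigenvalue of the sum is the sum of an eigenvalue of each. *)
Lemma integral_spectrumD d (A B : 'M[C]_d) :
    comm_mx A B -> integral_spectrum A -> integral_spectrum B ->
  integral_spectrum (A + B).
Proof.
move=> cAB intA intB a aAB.
have cABB : comm_mx (A + B) B.
  by apply/comm_mx_sym/comm_mxD; [apply: comm_mx_sym | apply: comm_mx_refl].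
have [b [v v_neq0 [vAB vB]]] := comm_mx_common_eigenvector cABB aAB.
have [|y b_int] := intB b; first by apply/eigenvalueP; exists v.
have [|x a_int] := intA (a - b).
  by apply/eigenvalueP; exists v; rewrite // scalerBl -vAB -vB mulmxDr addrK.
by exists (x + y); rewrite rmorphD /= -a_int -b_int subrK.
Qed.

Lemma integral_spectrum_sum d (I : Type) (r : seq I) (P : pred I)
    (F : I -> 'M[C]_d) :
    (forall i j, comm_mx (F i) (F j)) ->
    (forall i, integral_spectrum (F i)) ->
  integral_spectrum (\sum_(i <- r | P i) F i).
Proof.
move=> cF intF; elim: r => [|i r IHr].
  by rewrite big_nil; apply: integral_spectrum0.
rewrite big_cons; case: ifP => // _; apply: integral_spectrumD => //.
exact: comm_mx_sum.
Qed.

(** These are the relations of the degenerate affine Hecke algebra of rank 2.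
    Let v be a common eigenvector, with v X = a v and v Y = b v.  The plane
    spanned by v and v S is stable under X, and w = (b - a) v S - v is an
    eigenvector of X for b unless it vanishes.  If w = 0, then v = (b - a) v S,
    and applying S once more gives (b - a)^2 = 1. *)
Lemma integral_spectrum_hecke d (S X Y : 'M[C]_d) :
    S *m S = 1%:M -> Y *m S = S *m X + 1%:M -> comm_mx X Y ->
  integral_spectrum X -> integral_spectrum Y.
Proof.
move=> SS YS cXY intX b bY.
have [a [v v_neq0 [vY vX]]] :=
  comm_mx_common_eigenvector (comm_mx_sym cXY) bY.
have [x a_int] : exists z : int, a = z%:~R.
  by apply: intX; apply/eigenvalueP; exists v.
have vSX : v *m S *m X = b *: (v *m S) - v.
  by rewrite -mulmxA -[S *m X](addrK 1%:M) -YS mulmxBr mulmx1 mulmxA vY scalemxAl.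
pose w := (b - a) *: (v *m S) - v.
have [w0 | w_neq0] := eqVneq w 0; last first.
  apply: intX; apply/eigenvalueP; exists w => //.
  rewrite /w mulmxBl -scalemxAl vSX vX.
  apply/rowP=> j; rewrite !mxE; ring.
have vE : v = (b - a) *: (v *m S) by apply/esym/eqP; rewrite -subr_eq0 -/w w0.
have vSE : v *m S = (b - a) *: v.
  by rewrite {1}vE -scalemxAl -mulmxA SS mulmx1.
have /eqP : ((b - a) ^+ 2 - 1) *: v = 0.
  by rewrite scalerBl scale1r expr2 -scalerA -vSE -vE subrr.
rewrite scaler_eq0 (negPf v_neq0) orbF subr_eq0 sqrf_eq1.
case/orP=> /eqP ba; [exists (1 + x) | exists (-1 + x)];
  by rewrite rmorphD /= -a_int -(subrK a b) ba.
Qed.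

End IntegralSpectrum.

(** * Jucys-Murphy elements *)

Section JucysMurphy.

Variables (C : numClosedFieldType) (n d : nat).
Variable rG : mx_representation C [set: 'S_n] d.

Definition jucys_murphy (m : 'I_n) : 'M[C]_d :=
  \sum_(i < n | (i < m)%N) rG (tperm i m).

Let rGM s t : rG (s * t)%g = rG s *m rG t.
Proof. by rewrite repr_mxM ?in_setT. Qed.

(** Conjugation by s permutes the transpositions (i m) with i < m. *)
Lemma jucys_murphy_comm_perm (s : 'S_n) (m : 'I_n) :
    s m = m -> (forall i, (s i < m) = (i < m))%N ->
  comm_mx (rG s) (jucys_murphy m).
Proof.
move=> sm s_lt; rewrite /comm_mx mulmx_suml mulmx_sumr.
rewrite (reindex_perm s) /=; apply: eq_big => // i _.
by rewrite -!rGM -{1}sm -tpermJ conjgE !mulgA mulgV mul1g.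
Qed.

Lemma jucys_murphy_comm (l m : 'I_n) :
  comm_mx (jucys_murphy l) (jucys_murphy m).
Proof.
wlog le_lm: l m / (l <= m)%N.
  move=> IH; case/orP: (leq_total l m) => ?; first exact: IH.
  by apply: comm_mx_sym; apply: IH.
have [/val_inj-> | neq_lm] := eqVneq (l : nat) m; first exact: comm_mx_refl.
have lt_lm : (l < m)%N by rewrite ltn_neqAle neq_lm.
apply: comm_mx_sym; apply: comm_mx_sum => i lt_il.
apply: comm_mx_sym; apply: jucys_murphy_comm_perm => [|j].
  by rewrite tpermD // -val_eqE /= ltn_eqF // (ltn_trans lt_il).
by case: tpermP => // ->; rewrite ?lt_lm (ltn_trans lt_il).
Qed.

(** Conjugation by (l m) carries X_l to the sum of the (i m) with i < l, which
    is X_m without the term (l m); that term contributes the identity. *)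
Lemma jucys_murphy_step (l m : 'I_n) : m = l.+1 :> nat ->
  jucys_murphy m *m rG (tperm l m) =
    rG (tperm l m) *m jucys_murphy l + 1%:M.
Proof.
move=> ml; rewrite /jucys_murphy (bigD1 l) /= ?ml //.
rewrite mulmxDl -rGM tperm2 repr_mx1 addrC; congr (_ + _).
rewrite mulmx_suml mulmx_sumr; apply: eq_big => [i|i /andP[le_il neq_il]].
  by rewrite ltnS [RHS]ltn_neqAle andbC.
rewrite -!rGM.
have neq_im : i != m.
  by rewrite -val_eqE /= ltn_eqF // ml.
have <- : (tperm i m ^ tperm l m)%g = tperm i l.
  by rewrite tpermJ tpermR tpermD // eq_sym.
by rewrite conjgE !mulgA mulgV mul1g.
Qed.

Lemma jucys_murphy_integral (m : 'I_n) : integral_spectrum (jucys_murphy m).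
Proof.
case: m => m; elim: m => [|m IHm] lt_m.
  by rewrite /jucys_murphy big_pred0 //; apply: integral_spectrum0.
pose l := Ordinal (ltnW lt_m).
apply: (integral_spectrum_hecke (S := rG (tperm l (Ordinal lt_m)))
          (X := jucys_murphy l)).
- by rewrite -rGM tperm2 repr_mx1.
- exact: jucys_murphy_step.
- exact: jucys_murphy_comm.
- exact: IHm.
Qed.

End JucysMurphy.

(** * From the symmetric group to arrangement graphs *)

(** Row vectors are functions on G, on which the regular representation acts
    by right translation of the argument by the inverse. *)
Lemma regular_repr_row (F : fieldType) (gT : finGroupType) (G : {group gT})
    (f : gT -> F) (x : gT) : x \in G ->
  (\row_i f (enum_val i)) *m regular_repr F G x
    = \row_(i < gcard G) f (enum_val i * x^-1)%g.
Proof.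
move=> Gx; apply/rowP=> i; rewrite !mxE.
have Gix : (enum_val i * x^-1)%g \in G by rewrite groupM ?groupV ?enum_valP.
rewrite (bigD1 (gring_index G (enum_val i * x^-1))) //= !mxE eqxx /=.
rewrite gring_indexK // mulgKV gring_valK eqxx mulr1.
rewrite big1 ?addr0 // => j /negP neq_j; rewrite !mxE eqxx /=.
case: eqP => [ij|_]; last by rewrite mulr0.
case: neq_j; rewrite ij gring_indexK ?groupM ?enum_valP //.
by rewrite mulgK gring_valK.
Qed.

Section Restriction.

Variables (n k : nat) (le_kn : (k <= n)%N).

Lemma restrict_perm_subproof (s : 'S_n) :
  injectiveb [ffun i : 'I_k => s (widen_ord le_kn i)].
Proof.
apply/injectiveP=> i j; rewrite !ffunE => /perm_inj/(congr1 val) /= ij.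
exact: val_inj.
Qed.

Definition restrict_perm (s : 'S_n) : kperm n k :=
  Sub [ffun i : 'I_k => s (widen_ord le_kn i)] (restrict_perm_subproof s).

Lemma restrict_permE s i : val (restrict_perm s) i = s (widen_ord le_kn i).
Proof. by rewrite SubK ffunE. Qed.

(** Every injective p extends to a permutation: list the values of p, then the
    points that p misses. *)
Lemma restrict_perm_surj p : exists s, restrict_perm s = p.
Proof.
have /injectiveP p_inj := valP p.
(* A listing of all n points without repetition; position i of the list is
   the image of i under the permutation sought. *)
pose r := [seq val p i | i <- enum 'I_k]
            ++ enum [predC codom (val p)].
have size_r : size r = n.
  rewrite size_cat size_map -!cardE -(card_codom p_inj) cardC.
  exact: card_ord.
have uniq_r : uniq r.
  rewrite cat_uniq map_inj_uniq // !enum_uniq andbT /=.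
  apply/hasPn => x; rewrite mem_enum inE /= => /negP xp.
  by apply/negP => /mapP[i _ xi]; apply: xp; rewrite xi codom_f.
(* The default value i of nth is never reached, as r has size n. *)
have f_inj : injective (fun i : 'I_n => nth i r i).
  move=> i j; rewrite (set_nth_default j) ?size_r // => /eqP.
  by rewrite nth_uniq ?size_r // => /eqP/val_inj.
exists (perm f_inj); apply/val_inj/ffunP => i.
rewrite restrict_permE permE /= nth_cat size_map size_enum_ord ltn_ord.
by rewrite (nth_map i) ?size_enum_ord // nth_ord_enum.
Qed.

Lemma restrict_perm_tpermM (s : 'S_n) (i j : 'I_n) :
    (k <= i)%N -> (k <= j)%N ->
  restrict_perm (tperm i j * s) = restrict_perm s.
Proof.
move=> ki kj; apply/val_inj/ffunP => h; rewrite !restrict_permE permM tpermD //.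
  by rewrite -val_eqE /= gtn_eqF // (leq_trans _ ki).
by rewrite -val_eqE /= gtn_eqF // (leq_trans _ kj).
Qed.

Lemma restrict_perm_swap (s : 'S_n) (i h : 'I_k) (j : 'I_n) : (k <= j)%N ->
  val (restrict_perm (tperm (widen_ord le_kn i) j * s)) h
    = if h == i then s j else s (widen_ord le_kn h).
Proof.
move=> kj; rewrite restrict_permE permM.
have [-> | neq_hi] := eqVneq h i; first by rewrite tpermL.
rewrite tpermD // -val_eqE /=; first by rewrite eq_sym.
by rewrite gtn_eqF // (leq_trans _ kj).
Qed.

Definition swap_restrict (s : 'S_n) (ij : 'I_k * 'I_n) : kperm n k :=
  restrict_perm (tperm (widen_ord le_kn ij.1) ij.2 * s).

Lemma widen_ord_neq (i : 'I_k) (j : 'I_n) : (k <= j)%N -> j != widen_ord le_kn i.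
Proof. by move=> kj; rewrite -val_eqE /= gtn_eqF // (leq_trans _ kj). Qed.

Lemma swap_restrict_inj s :
  {in [pred ij : 'I_k * 'I_n | (k <= ij.2)%N] &, injective (swap_restrict s)}.
Proof.
move=> [i j] [i' j']; rewrite !inE /= => kj kj' eq_ij.
have /(congr1 (fun p : kperm n k => val p i)) := eq_ij.
rewrite /swap_restrict /= !restrict_perm_swap // eqxx.
have [<- /perm_inj -> // | _ /perm_inj/eqP] := eqVneq i i'.
by rewrite (negPf (widen_ord_neq i kj)).
Qed.

(** If q differs from the restriction of s only at position i, then q i is a
    value that s takes outside the first k positions, since q is injective;
    so q comes from swapping i with the position j where s takes that value. *)
Lemma arrangement_swapP s :
  [set q | arrangement 1 (restrict_perm s) q]
    = swap_restrict s @: [pred ij : 'I_k * 'I_n | (k <= ij.2)%N].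
Proof.
apply/setP => q; rewrite inE; apply/cards1P/imsetP => [[i diff_i]|].
  have agree h : (val q h == s (widen_ord le_kn h)) = (h != i).
    move/setP/(_ h): diff_i; rewrite !inE restrict_permE eq_sym => <-.
    by rewrite negbK.
  pose j := (s^-1)%g (val q i).
  have sj : s j = val q i by rewrite permKV.
  have /injectiveP q_inj := valP q.
  have kj : (k <= j)%N.
    rewrite leqNgt; apply/negP => lt_jk.
    have jE : j = widen_ord le_kn (Ordinal lt_jk) by apply: val_inj.
    have := agree (Ordinal lt_jk); rewrite -jE sj.
    have [<-|neq_ji] := eqVneq (Ordinal lt_jk) i; first by rewrite eqxx.
    by rewrite (inj_eq q_inj) (negPf neq_ji).
  exists (i, j) => //; apply/val_inj/ffunP => h.
  rewrite restrict_perm_swap //=; case: eqVneq => [->//|neq_hi].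
  by apply/eqP; rewrite agree.
case=> -[i j]; rewrite inE /= => kj ->; exists i.
apply/setP => h; rewrite !inE restrict_perm_swap // restrict_permE.
rewrite /=; case: (eqVneq h i) => [->|_]; last by rewrite eqxx.
by rewrite (inj_eq perm_inj) eq_sym widen_ord_neq.
Qed.

(** The left side is the action of X_k + ... + X_(n-1) on the lift of phi to
    S_n.  The terms with i < k run over the neighbours of the restriction of s,
    each occurring once by injectivity of [swap_restrict]; the terms with
    k <= i do not move the restriction, and are counted by the multiplicity. *)
Lemma sum_jucys_murphy_restrict (R : pzRingType) (phi : kperm n k -> R)
    (s : 'S_n) :
  \sum_(m < n | (k <= m)%N) \sum_(i < n | (i < m)%N)
      phi (restrict_perm (tperm i m * s))
    = \sum_(q | arrangement 1 (restrict_perm s) q) phi q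
      + phi (restrict_perm s)
          *+ (\sum_(m < n | (k <= m)%N) #|[pred i : 'I_n | k <= i < m]|)%N.
Proof.
under eq_bigr => m km.
  rewrite (bigID (fun i : 'I_n => (i < k)%N)) /=.
  rewrite [X in _ + X](_ : _ =
    phi (restrict_perm s) *+ #|[pred i : 'I_n | (k <= i < m)%N]|); last first.
    rewrite -sumr_const; apply: eq_big => i; first by rewrite inE -leqNgt andbC.
    by rewrite -leqNgt => /andP[_ ki]; rewrite restrict_perm_tpermM.
  rewrite (eq_bigl (fun i : 'I_n => (i < k)%N)); last first.
    by move=> i /=; case: (ltnP i k) => ik; rewrite ?andbF // andbT (leq_trans ik).
  rewrite (big_ord_narrow le_kn).
  over.
rewrite big_split /= -sumrMnr; congr (_ + _).
rewrite exchange_big pair_big_dep /=.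
have := big_imset (aop := +%R) phi (@swap_restrict_inj s).
rewrite -arrangement_swapP; under eq_bigl => q do rewrite inE.
by move=> ->; apply: eq_bigl => -[i j].
Qed.

End Restriction.

Theorem theorem1p5 (C : numClosedFieldType) (n k : nat)
    (hk : (1 <= k)%N) (hkn : (k <= n)%N) (a : C) :
  eigenvalue (adjmx C (@arrangement n k 1)) a -> exists z : int, a = z%:~R.
Proof.
case/eigenvalueP => v vA v_neq0.
pose phi (p : kperm n k) := v 0 (enum_rank p).
have phiA p : \sum_(q | arrangement 1 p q) phi q = a * phi p.
  transitivity ((v *m adjmx C (@arrangement n k 1)) 0 (enum_rank p)); last first.
    by rewrite vA mxE.
  rewrite mxE (reindex enum_rank) /=; last first.
    by exists enum_val => ? _; rewrite ?enum_rankK ?enum_valK.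
  rewrite big_mkcond; apply: eq_bigr => q _.
  rewrite mxE !enum_rankK arrangement_sym mulr_natr mulrb /phi.
  by case: ifP.
pose rG := regular_repr C [set: 'S_n].
pose c := (\sum_(m < n | (k <= m)%N) #|[pred i : 'I_n | k <= i < m]|)%N.
pose J := \sum_(m < n | (k <= m)%N) jucys_murphy rG m.
(* Right translation on S_n becomes precomposition with a transposition only
   after inversion, hence the inverse. *)
pose f (s : 'S_n) := phi (restrict_perm hkn s^-1).
pose w : 'rV_(gcard [set: 'S_n]) := \row_i f (enum_val i).
have wJ : w *m J = (a + c%:R) *: w.
  apply/rowP => g; rewrite mulmx_sumr summxE.
  rewrite [RHS]mxE [X in _ * X]mxE mulrDl -phiA mulr_natl -sum_jucys_murphy_restrict.
  apply: eq_bigr => m _; rewrite mulmx_sumr summxE; apply: eq_bigr => i _.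
  by rewrite regular_repr_row ?in_setT // mxE /f invMg invgK.
have w_neq0 : w != 0.
  case/rV0Pn: v_neq0 => x vx; have [s sE] := restrict_perm_surj hkn (enum_val x).
  apply/rV0Pn; exists (gring_index [set: 'S_n] s^-1).
  by rewrite mxE gring_indexK ?in_setT // /f invgK sE /phi enum_valK.
have [z az] : exists z : int, a + c%:R = z%:~R.
  apply: (integral_spectrum_sum (r := index_enum 'I_n)
    (P := fun m : 'I_n => (k <= m)%N) (F := jucys_murphy rG)).
  - exact: jucys_murphy_comm.
  - exact: jucys_murphy_integral.
  by apply/eigenvalueP; exists w.
by exists (z - c%:Z); rewrite rmorphB /= -az addrK.
Qed.
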